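(* Let $G:\mathbb{R}^2\to\mathbb{R}$ and constants $L\ge c>0$ satisfy, for all $u,u_0,v\in\mathbb{R}$, $|G(u,v)-G(u_0,v)|\le L|u-u_0|$ and $|G(u,v)|\ge c\sqrt{u^2+v^2}$. Let $n,m\ge1$, fix $i\in\{1,\dots,n\}$, and let $f\in L^2((0,1)^n)$ (not a.e. constant) and $h\in L^2((0,1)^{n+m-1})$ be real-valued. Suppose $g:(0,1)^{n+m}\to\mathbb{R}$ belongs to $L^2((0,1)^{n+m})$, satisfies $g(x,\xi)=G(f(x),h(x_{\sim i},\xi))$, and has mean $g_0=0$. Then $$S^g_{T_{x_i}}\le 2\frac{L^2}{c^2}\,\frac{\mathrm{Var}(f)}{\mathrm{Var}(f)+\mathrm{Var}(h)}\,S^f_{T_{x_i}}.$$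
   Context: All integrals are with respect to Lebesgue measure over unit cubes (inputs independent, uniform on $[0,1]$). $x_{\sim i}=(x_1,\dots,x_{i-1},x_{i+1},\dots,x_n)$. For $\varphi$, $\varphi_0=\int\varphi$ and $\mathrm{Var}(\varphi)=\int\varphi^2-\varphi_0^2$. The total Sobol index of $x_i$ for a square-integrable $\varphi$ of $(x,y)$ is $$S^\varphi_{T_{x_i}}=\frac{\int\varphi^2\,dx\,dy-\int\big(\int\varphi\,dx_i\big)^2dx_{\sim i}\,dy}{\mathrm{Var}(\varphi)}.$$ *)

(* Defs.v *)
From HB Require Import structures.
From mathcomp Require Import all_boot all_order all_algebra.
From mathcomp Require Import all_classical all_reals all_analysis.
Set Implicit Arguments. Unset Strict Implicit. Unset Printing Implicit Defensive.
Import Order.TTheory GRing.Theory Num.Theory.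
Import numFieldNormedType.Exports.
Local Open Scope classical_set_scope.
Local Open Scope ring_scope.

Section cube.
Variable R : realType.

Definition cube (k : nat) : set (k.-tuple R) :=
  [set z | forall j : 'I_k, 0 < tnth z j < 1].

(* Iterated Lebesgue integral over (0,1)^k of a function R^k -> \bar R.
   For nonnegative measurable functions this is (Tonelli) the integral
   against the k-dimensional Lebesgue measure restricted to (0,1)^k. *)
Fixpoint cube_int (k : nat) : (k.-tuple R -> \bar R) -> \bar R :=
  match k with
  | 0 => fun phi => phi [tuple]
  | k'.+1 => fun phi =>
      (\int[@lebesgue_measure R]_(t in `]0%R, 1%R[) cube_int (fun w : k'.-tuple R => phi [tuple of t :: w]))%E
  end.

Definition cube_measure (k : nat) (A : set (k.-tuple R)) : \bar R :=
  cube_int (fun z => (\1_A z)%:E).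

Definition L2cube (k : nat) (phi : k.-tuple R -> R) : Prop :=
  measurable_fun (@cube k) phi /\
  (cube_int (fun z => (phi z ^+ 2)%:E) < +oo)%E.

Definition ae_const (k : nat) (phi : k.-tuple R -> R) : Prop :=
  exists a : R, cube_measure [set z | phi z != a] = 0%E.

Definition sq_int (k : nat) (phi : k.-tuple R -> R) : R :=
  fine (cube_int (fun z => (phi z ^+ 2)%:E)).

Definition cube_mean (k : nat) (phi : k.-tuple R -> R) : R :=
  fine (cube_int (fun z => (Num.max (phi z) 0)%:E))
  - fine (cube_int (fun z => (Num.max (- phi z) 0)%:E)).

Definition cube_var (k : nat) (phi : k.-tuple R -> R) : R :=
  sq_int phi - cube_mean phi ^+ 2.

Definition tins (k : nat) (j : 'I_k) (t : R) (w : k.-1.-tuple R) : k.-tuple R :=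
  [tuple match unlift j l with Some l' => tnth w l' | None => t end | l < k].

Definition partial_int (k : nat) (j : 'I_k) (phi : k.-tuple R -> R)
    (w : k.-1.-tuple R) : R :=
  fine (\int[@lebesgue_measure R]_(t in `]0%R, 1%R[) (phi (tins j t w))%:E)%E.

Definition total_sobol (k : nat) (phi : k.-tuple R -> R) (j : 'I_k) : R :=
  (sq_int phi - sq_int (partial_int j phi)) / cube_var phi.

Definition xpart (n m : nat) (z : (n + m).-tuple R) : n.-tuple R :=
  [tuple tnth z (lshift m l) | l < n].

Definition drop_coord (k : nat) (j : 'I_k) (z : k.-tuple R) : k.-1.-tuple R :=
  [tuple tnth z (lift j l) | l < k.-1].

End cube.

(* Main.v *)
Require Import Defs.
From HB Require Import structures.
From mathcomp Require Import all_boot all_order all_algebra.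
From mathcomp Require Import all_classical all_reals all_analysis.
From mathcomp Require Import measurable_realfun ring lra.
Set Implicit Arguments. Unset Strict Implicit. Unset Printing Implicit Defensive.
Import Order.TTheory GRing.Theory Num.Theory.
Import numFieldNormedType.Exports.
Local Open Scope classical_set_scope.
Local Open Scope ring_scope.

(* For fixed [w = (x_{~i}, xi)], the section [t |-> g] is the image of the
   section of [f] under the L-Lipschitz map [G(., h w)], so its variance is at
   most [L^2] times that of the section of [f].  Integrating over [w] (Tonelli)
   bounds the numerator of the index of [g] by [L^2] times the numerator for [f].
   The lower bound on [|G|] and [g_0 = 0] give
   [Var g = int g^2 >= c^2 (int f^2 + int h^2) >= c^2 (Var f + Var h)].
   The factor 2 in the theorem is slack. *)

(** * Tonelli over the unit interval *)

Section cube_integral.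
Variable R : realType.
Local Notation mu := (@lebesgue_measure R).
Local Open Scope ereal_scope.

(** Extending [F] by zero off [T] times the open unit interval turns the restricted integral into a
    full section integral, whose measurability is part of Tonelli's theorem. *)
Lemma measurable_int01 d (T : measurableType d) (F : T * R -> \bar R) :
  (forall p, 0 <= F p) -> measurable_fun setT F ->
  measurable_fun setT (fun x => \int[mu]_(t in `]0%R, 1%R[) F (x, t)).
Proof.
move=> F0 mF.
pose D := [set: T] `*` (`]0%R, 1%R[%classic : set R).
have mD : measurable D by exact: measurableX.
have mFD : measurable_fun setT (F \_ D).
  by apply/(measurable_restrictT _ mD); exact: measurable_funS mF.
have FD0 p : 0 <= (F \_ D) p by exact: erestrict_ge0.
have := measurable_fun_fubini_tonelli_F (m2 := mu) _ mFD FD0.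
apply: eq_measurable_fun => x _; rewrite /fubini_F [RHS]integral_mkcond.
apply: eq_integral => t _; rewrite !patchE; congr (if _ then _ else _).
by apply/idP/idP; rewrite !inE /D/=; [case|split].
Qed.

(** Tonelli on the plane, applied to the extension of [F] by zero off the open unit square. *)
Lemma int01_swap (F : R * R -> \bar R) :
  (forall p, 0 <= F p) -> measurable_fun setT F ->
  \int[mu]_(s in `]0%R, 1%R[) \int[mu]_(t in `]0%R, 1%R[) F (s, t) =
  \int[mu]_(t in `]0%R, 1%R[) \int[mu]_(s in `]0%R, 1%R[) F (s, t).
Proof.
move=> F0 mF.
pose I := (`]0%R, 1%R[%classic : set R).
have mD : measurable (I `*` I) by apply: measurableX; exact: measurable_itv.
have mFD : measurable_fun setT (F \_ (I `*` I)).
  by apply/(measurable_restrictT _ mD); exact: measurable_funS mF.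
have FD0 p : 0 <= (F \_ (I `*` I)) p by exact: erestrict_ge0.
have := fubini_tonelli (m1 := mu) (m2 := mu) _ mFD FD0.
have E s t : (F \_ (I `*` I)) (s, t) =
    if s \in I then (if t \in I then F (s, t) else 0) else 0.
  rewrite patchE; have -> : ((s, t) \in I `*` I) = (s \in I) && (t \in I).
    apply/idP/andP; first by rewrite !inE => -[].
    by case; rewrite !inE => ? ?; split.
  by case: (s \in I); case: (t \in I).
congr (_ = _); rewrite [RHS]integral_mkcond; apply: eq_integral => x _.
- rewrite patchE; case: ifPn => xI.
    rewrite [RHS]integral_mkcond; apply: eq_integral => t _.
    by rewrite E xI patchE.
  by apply: integral0_eq => t _; rewrite E (negbTE xI).
- rewrite patchE; case: ifPn => xI.
    rewrite [RHS]integral_mkcond; apply: eq_integral => t _.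
    by rewrite E xI patchE.
  by apply: integral0_eq => t _; rewrite E (negbTE xI); case: ifP.
Qed.

Lemma int01_cst (r : \bar R) : \int[mu]_(t in `]0%R, 1%R[) r = r.
Proof.
rewrite integral_cst//= lebesgue_measure_itv/= lte_fin ltr01 -EFinB subr0.
by rewrite mule1.
Qed.

(** * Measurability of the coordinate maps *)

Lemma measurable_mktuple d1 d2 (T1 : measurableType d1)
    (T2 : measurableType d2) n (e : 'I_n -> T1 -> T2) :
  (forall l, measurable_fun setT (e l)) ->
  measurable_fun setT (fun x => [tuple e l x | l < n]).
Proof.
move=> me; apply/measurable_fun_tnthP => l.
by apply: eq_measurable_fun (me l) => x _; rewrite /= tnth_mktuple.
Qed.

Lemma measurable_tins k (j : 'I_k) :
  measurable_fun setT (fun p : k.-1.-tuple R * R => tins j p.2 p.1).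
Proof.
apply: measurable_mktuple => l; case: unliftP => [l' _|_] /=.
  by apply: measurableT_comp (measurable_tnth _) _.
exact: measurable_snd.
Qed.

Lemma measurable_xpart n m : measurable_fun setT (@xpart R n m).
Proof. by apply: measurable_mktuple => l; exact: measurable_tnth. Qed.

Lemma measurable_drop_coord k (j : 'I_k) :
  measurable_fun setT (@drop_coord R k j).
Proof. by apply: measurable_mktuple => l; exact: measurable_tnth. Qed.

(** * The iterated integral of nonnegative functions on the cube *)

Lemma cube_cons k (t : R) (w : k.-tuple R) :
  cube [tuple of t :: w] <-> (0 < t < 1)%R /\ cube w.
Proof.
split=> [tw|[t01 w01] j].
  split; first exact: (tw ord0).
  by move=> j; have := tw (lift ord0 j); rewrite tnthS.
by case: (unliftP ord0 j) => [l|] ->; rewrite ?tnthS// tnth0.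
Qed.

Lemma measurable_cube k : measurable (@cube R k).
Proof.
have -> : @cube R k =
    \bigcap_(j in [set: 'I_k]) [set z | 0 < tnth z j < 1]%R.
  by apply/seteqP; split => z /=; [move=> zc j _|move=> zc j]; exact: zc.
apply: fin_bigcap_measurable => // j _.
have := @measurable_tnth _ R k j measurableT `]0%R, 1%R[%classic.
rewrite setTI; apply; exact: measurable_itv.
Qed.

Lemma eq_cube_int k (phi psi : k.-tuple R -> \bar R) :
  (forall z, cube z -> phi z = psi z) -> cube_int phi = cube_int psi.
Proof.
elim: k phi psi => [|k IH] phi psi e /=; first by apply: e => -[].
apply: eq_integral => t; rewrite inE/= in_itv/= => t01.
by apply: IH => w w01; apply: e; apply/cube_cons.
Qed.

Lemma cube_int_ge0 k (phi : k.-tuple R -> \bar R) :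
  (forall z, 0 <= phi z) -> 0 <= cube_int phi.
Proof.
elim: k phi => [|k IH] phi phi0 //=.
by apply: integral_ge0 => t _; exact: IH.
Qed.

(** The parameter space is arbitrary so that the induction on [k] can absorb the head coordinate
    into it, passing from [T] to [T * R]. *)
Lemma measurable_cube_int d (T : measurableType d) k
    (F : T * k.-tuple R -> \bar R) :
  (forall p, 0 <= F p) -> measurable_fun setT F ->
  measurable_fun setT (fun x => cube_int (fun w => F (x, w))).
Proof.
elim: k d T F => [|k IH] d T F F0 mF /=.
  by apply: measurableT_comp mF _; exact: pair2_measurable.
apply: (measurable_int01
  (F := fun p => cube_int (fun w => F (p.1, [tuple of p.2 :: w])))).
  by move=> p; exact: cube_int_ge0.
apply: (IH _ _ (fun q => F (q.1.1, [tuple of q.1.2 :: q.2]))) => //.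
apply: measurableT_comp mF _.
apply: measurable_fun_pair; first by apply: measurableT_comp.
by apply: measurable_cons => //; apply: measurableT_comp.
Qed.

Lemma measurable_comp_cons k (phi : k.+1.-tuple R -> \bar R) :
  measurable_fun setT phi ->
  measurable_fun setT (fun p : R * k.-tuple R => phi [tuple of p.1 :: p.2]).
Proof. by move=> mphi; apply: measurableT_comp mphi _; exact: measurable_cons. Qed.

Lemma measurable_cons_slice k (phi : k.+1.-tuple R -> \bar R) (t : R) :
  measurable_fun setT phi ->
  measurable_fun setT (fun w : k.-tuple R => phi [tuple of t :: w]).
Proof.
by move=> mphi; apply: measurableT_comp mphi _; exact: measurable_cons.
Qed.

Lemma measurable_cube_int_slice k (phi : k.+1.-tuple R -> \bar R) :
  (forall z, 0 <= phi z) -> measurable_fun setT phi ->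
  measurable_fun setT
    (fun t : R => cube_int (fun w : k.-tuple R => phi [tuple of t :: w])).
Proof.
move=> phi0 /measurable_comp_cons mphi.
exact: (measurable_cube_int (F := fun p => phi [tuple of p.1 :: p.2])).
Qed.

Lemma le_cube_int k (phi psi : k.-tuple R -> \bar R) :
  (forall z, 0 <= phi z) -> measurable_fun setT phi -> measurable_fun setT psi ->
  (forall z, cube z -> phi z <= psi z) -> cube_int phi <= cube_int psi.
Proof.
move=> phi0 mphi mpsi le_phi_psi.
(* The maximum agrees with [psi] on the cube and dominates [phi] everywhere, so the induction can
   run on an inequality without side condition, with a nonnegative upper function. *)
pose psi' z := maxe (phi z) (psi z).
have mpsi' : measurable_fun setT psi' by exact: measurable_maxe.
rewrite (eq_cube_int (phi := psi) (psi := psi')); last first.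
  by move=> z cz; rewrite /psi' max_r// le_phi_psi.
have : forall z, phi z <= psi' z by move=> z; rewrite /psi' le_max lexx.
move: psi' mpsi' => {}psi {}mpsi {}le_phi_psi.
elim: k => [|k IH] in phi psi phi0 mphi mpsi le_phi_psi * => //=.
have psi0 z : 0 <= psi z by exact: le_trans (le_phi_psi z).
apply: ge0_le_integral => //.
- by move=> t _; exact: cube_int_ge0.
- by apply: measurable_funTS; exact: measurable_cube_int_slice.
- by apply: measurable_funTS; exact: measurable_cube_int_slice.
- by move=> t _; apply: IH => //; exact: measurable_cons_slice.
Qed.

Lemma cube_intD k (phi psi : k.-tuple R -> \bar R) :
  (forall z, 0 <= phi z) -> measurable_fun setT phi ->
  (forall z, 0 <= psi z) -> measurable_fun setT psi ->
  cube_int (fun z => phi z + psi z) = cube_int phi + cube_int psi.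
Proof.
elim: k => [|k IH] in phi psi * => phi0 mphi psi0 mpsi //=.
rewrite -ge0_integralD//; first last.
- by apply: measurable_funTS; exact: measurable_cube_int_slice.
- by move=> t _; exact: cube_int_ge0.
- by apply: measurable_funTS; exact: measurable_cube_int_slice.
- by move=> t _; exact: cube_int_ge0.
apply: eq_integral => t _.
by rewrite -IH//; exact: measurable_cons_slice.
Qed.

Lemma cube_intZ k (phi : k.-tuple R -> \bar R) (r : \bar R) :
  (forall z, 0 <= phi z) -> measurable_fun setT phi -> 0 <= r ->
  cube_int (fun z => r * phi z) = r * cube_int phi.
Proof.
elim: k => [|k IH] in phi * => phi0 mphi r0 //=.
rewrite -ge0_integralZl//; first last.
- by move=> t _; exact: cube_int_ge0.
- by apply: measurable_funTS; exact: measurable_cube_int_slice.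
apply: eq_integral => t _.
by rewrite -IH//; exact: measurable_cons_slice.
Qed.

Lemma cube_int_cst k (r : \bar R) : cube_int (fun _ : k.-tuple R => r) = r.
Proof. by elim: k => [//|k IH] /=; rewrite IH int01_cst. Qed.

(** The first [n] coordinates are peeled off one by one; what remains is a constant integrated over
    the last [m], where the cube has mass 1. *)
Lemma cube_int_xpart n m (phi : n.-tuple R -> \bar R) :
  cube_int (fun z : (n + m).-tuple R => phi (xpart z)) = cube_int phi.
Proof.
elim: n phi => [|n IH] phi /=.
  rewrite -[RHS](cube_int_cst m); congr cube_int; apply/funext => z.
  by congr phi; apply: eq_from_tnth => -[].
apply: eq_integral => t _; rewrite -IH; congr cube_int; apply/funext => z.
congr phi; apply: eq_from_tnth => l; rewrite tnth_mktuple.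
case: (unliftP ord0 l) => [l'|] -> //.
rewrite tnthS tnth_mktuple.
have -> : lshift m (lift ord0 l') = lift ord0 (lshift m l') :> 'I_(n + m).+1.
  exact: val_inj.
exact: tnthS.
Qed.

(** * Inserting and deleting a coordinate; Tonelli along any coordinate *)

Lemma tnth_tins_id k (j : 'I_k) (t : R) w : tnth (tins j t w) j = t.
Proof. by rewrite tnth_mktuple unlift_none. Qed.

Lemma tnth_tins_lift k (j : 'I_k) (t : R) w l :
  tnth (tins j t w) (lift j l) = tnth w l.
Proof. by rewrite tnth_mktuple liftK. Qed.

Lemma eq_tins k (j : 'I_k) (t : R) w (z : k.-tuple R) :
  tnth z j = t -> (forall l, tnth z (lift j l) = tnth w l) -> z = tins j t w.
Proof.
move=> zj zl; apply: eq_from_tnth => l; case: (unliftP j l) => [l'|] ->.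
  by rewrite zl tnth_tins_lift.
by rewrite zj tnth_tins_id.
Qed.

Lemma tins0 k (t : R) (w : k.-tuple R) :
  tins (ord0 : 'I_k.+1) t w = [tuple of t :: w].
Proof. by apply/esym/eq_tins => // l; rewrite tnthS. Qed.

Lemma tinsS k (j : 'I_k.+1) (s t : R) (w : k.-tuple R) :
  tins (lift ord0 j) t [tuple of s :: w] = [tuple of s :: tins j t w].
Proof.
apply/esym/eq_tins => [|l]; first by rewrite tnthS tnth_tins_id.
case: (unliftP ord0 l) => [l'|] ->.
  rewrite tnthS (_ : lift _ _ = lift ord0 (lift j l')) ?tnthS ?tnth_tins_lift//.
  by apply: val_inj; rewrite /= /bump /= !add1n ltnS addnS.
by rewrite (_ : lift _ _ = ord0)//; exact: val_inj.
Qed.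

Lemma drop_coord_tins k (j : 'I_k) (t : R) w : drop_coord j (tins j t w) = w.
Proof. by apply: eq_from_tnth => l; rewrite tnth_mktuple tnth_tins_lift. Qed.

Lemma cube_tins k (j : 'I_k) (t : R) w :
  (0 < t < 1)%R -> cube w -> cube (tins j t w).
Proof.
move=> t01 cw l; case: (unliftP j l) => [l'|] ->.
  by rewrite tnth_tins_lift.
by rewrite tnth_tins_id.
Qed.

Lemma cube_xpart n m (z : (n + m).-tuple R) : cube z -> cube (xpart z).
Proof. by move=> cz l; rewrite tnth_mktuple. Qed.

Lemma cube_drop_coord k (j : 'I_k) (z : k.-tuple R) :
  cube z -> cube (drop_coord j z).
Proof. by move=> cz l; rewrite tnth_mktuple. Qed.

(** The integral in [t] moves inward past one coordinate at a time, each move being [int01_swap]. *)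
Lemma cube_int_swap k (F : R * k.-tuple R -> \bar R) :
  (forall p, 0 <= F p) -> measurable_fun setT F ->
  \int[mu]_(t in `]0%R, 1%R[) cube_int (fun w => F (t, w)) =
  cube_int (fun w => \int[mu]_(t in `]0%R, 1%R[) F (t, w)).
Proof.
elim: k F => [//|k IH] F F0 mF /=.
rewrite (int01_swap
  (F := fun p => cube_int (fun w => F (p.1, [tuple of p.2 :: w])))).
- apply: eq_integral => s _.
  apply: (IH (fun p => F (p.1, [tuple of s :: p.2]))) => //.
  apply: measurableT_comp mF _; apply: measurable_fun_pair => //.
  exact: measurable_cons.
- by move=> p; exact: cube_int_ge0.
- apply: (measurable_cube_int
    (F := fun q => F (q.1.1, [tuple of q.1.2 :: q.2]))) => //.
  apply: measurableT_comp mF _.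
  apply: measurable_fun_pair; first by apply: measurableT_comp.
  by apply: measurable_cons => //; apply: measurableT_comp.
Qed.

(** Tonelli in the form used for Sobol indices: coordinate [j] becomes the innermost one. For the
    head coordinate this is [cube_int_swap]; otherwise the head is kept outside and the induction
    hypothesis acts on the tail. *)
Lemma cube_int_tins k (j : 'I_k) (phi : k.-tuple R -> \bar R) :
  (forall z, 0 <= phi z) -> measurable_fun setT phi ->
  cube_int phi =
  cube_int (fun w => \int[mu]_(t in `]0%R, 1%R[) phi (tins j t w)).
Proof.
elim: k j phi => [[]//|k IH] j phi phi0 mphi.
case: (unliftP ord0 j) => [j'|] {j}-> /=.
  (* With [k] a successor, the tuple of size [k.+1.-1] splits into a head and a tail; for [k] zero
     there is no index [j']. *)
  case: k => [|k] in IH j' phi phi0 mphi *; first by case: j'.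
  apply: eq_integral => s _; rewrite (IH j')//; last exact: measurable_cons_slice.
  congr cube_int; apply/funext => w; apply: eq_integral => t _.
  by congr phi; exact/esym/tinsS.
rewrite (cube_int_swap (F := fun p => phi [tuple of p.1 :: p.2]))//; last first.
  exact: measurable_comp_cons.
congr cube_int; apply/funext => w; apply: eq_integral => t _.
by rewrite tins0.
Qed.

(* Finite integrals as real numbers *)
Local Close Scope ereal_scope.

(** Sign and measurability are asked on the whole space, as in the lemmas on [cube_int]; functions
    known only on the cube are first extended by zero. *)
Definition cube_nnintegrable k (phi : k.-tuple R -> R) :=
  [/\ forall z, 0 <= phi z, measurable_fun setT phi
    & (cube_int (fun z => (phi z)%:E) < +oo)%E].

Definition cube_Rint k (phi : k.-tuple R -> R) : R :=
  fine (cube_int (fun z => (phi z)%:E)).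

Lemma cube_RintK k (phi : k.-tuple R -> R) : cube_nnintegrable phi ->
  cube_int (fun z => (phi z)%:E) = (cube_Rint phi)%:E.
Proof.
move=> [phi0 _ phioo]; rewrite fineK// ge0_fin_numE//.
by apply: cube_int_ge0 => z; rewrite lee_fin.
Qed.

Lemma cube_Rint_ge0 k (phi : k.-tuple R -> R) :
  (forall z, 0 <= phi z) -> 0 <= cube_Rint phi.
Proof. by move=> phi0; apply/fine_ge0/cube_int_ge0 => z; rewrite lee_fin. Qed.

Lemma cube_int_EFinD k (phi psi : k.-tuple R -> R) :
  cube_nnintegrable phi -> cube_nnintegrable psi ->
  cube_int (fun z => (phi z + psi z)%:E) =
  (cube_Rint phi + cube_Rint psi)%:E.
Proof.
move=> iphi ipsi; rewrite EFinD -!cube_RintK// -cube_intD//.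
- by move=> z; rewrite lee_fin; case: iphi.
- by apply/measurable_EFinP; case: iphi.
- by move=> z; rewrite lee_fin; case: ipsi.
- by apply/measurable_EFinP; case: ipsi.
Qed.

Lemma cube_nnintegrableD k (phi psi : k.-tuple R -> R) :
  cube_nnintegrable phi -> cube_nnintegrable psi ->
  cube_nnintegrable (fun z => phi z + psi z).
Proof.
move=> iphi ipsi; split.
- by move=> z; case: iphi => + _ _; case: ipsi => + _ _; move=> *; exact: addr_ge0.
- by case: iphi => _ + _; case: ipsi => _ + _; move=> *; exact: measurable_funD.
- by rewrite cube_int_EFinD// ltry.
Qed.

Lemma cube_RintD k (phi psi : k.-tuple R -> R) :
  cube_nnintegrable phi -> cube_nnintegrable psi ->
  cube_Rint (fun z => phi z + psi z) = cube_Rint phi + cube_Rint psi.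
Proof. by move=> iphi ipsi; rewrite /cube_Rint cube_int_EFinD. Qed.

Lemma cube_int_EFinZ k (phi : k.-tuple R -> R) r :
  cube_nnintegrable phi -> 0 <= r ->
  cube_int (fun z => (r * phi z)%:E) = (r * cube_Rint phi)%:E.
Proof.
move=> iphi r0; rewrite EFinM -!cube_RintK// -cube_intZ//.
- by move=> z; rewrite lee_fin; case: iphi.
- by apply/measurable_EFinP; case: iphi.
Qed.

Lemma cube_nnintegrableZ k (phi : k.-tuple R -> R) r :
  cube_nnintegrable phi -> 0 <= r -> cube_nnintegrable (fun z => r * phi z).
Proof.
move=> iphi r0; split.
- by move=> z; case: iphi => + _ _; move=> *; exact: mulr_ge0.
- by case: iphi => _ + _; move=> *; exact: measurable_funM.
- by rewrite cube_int_EFinZ// ltry.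
Qed.

Lemma cube_RintZ k (phi : k.-tuple R -> R) r :
  cube_nnintegrable phi -> 0 <= r ->
  cube_Rint (fun z => r * phi z) = r * cube_Rint phi.
Proof. by move=> iphi r0; rewrite /cube_Rint cube_int_EFinZ. Qed.

Lemma cube_Rint_cst k (r : R) : cube_Rint (fun _ : k.-tuple R => r) = r.
Proof. by rewrite /cube_Rint cube_int_cst. Qed.

Lemma cube_nnintegrable_cst k (r : R) : 0 <= r ->
  cube_nnintegrable (fun _ : k.-tuple R => r).
Proof. by move=> r0; split=> //; rewrite cube_int_cst ltry. Qed.

Lemma cube_nnintegrable_le k (phi psi : k.-tuple R -> R) :
  (forall z, 0 <= phi z) -> measurable_fun setT phi ->
  (forall z, cube z -> phi z <= psi z) ->
  cube_nnintegrable psi -> cube_nnintegrable phi.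
Proof.
move=> phi0 mphi le_phi_psi [_ mpsi psioo]; split=> //.
apply: le_lt_trans psioo; apply: le_cube_int.
- by move=> z; rewrite lee_fin.
- exact/measurable_EFinP.
- exact/measurable_EFinP.
- by move=> z /le_phi_psi; rewrite lee_fin.
Qed.

Lemma le_cube_Rint k (phi psi : k.-tuple R -> R) :
  cube_nnintegrable phi -> cube_nnintegrable psi ->
  (forall z, cube z -> phi z <= psi z) -> cube_Rint phi <= cube_Rint psi.
Proof.
move=> iphi ipsi le_phi_psi; rewrite -lee_fin -!cube_RintK//.
case: iphi => phi0 mphi _; case: ipsi => _ mpsi _; apply: le_cube_int.
- by move=> z; rewrite lee_fin.
- exact/measurable_EFinP.
- exact/measurable_EFinP.
- by move=> z /le_phi_psi; rewrite lee_fin.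
Qed.

Lemma cube_nnintegrable_sqr k (phi : k.-tuple R -> R) :
  measurable_fun setT phi ->
  (cube_int (fun z => (phi z ^+ 2)%:E) < +oo)%E ->
  cube_nnintegrable (fun z => phi z ^+ 2).
Proof. by move=> mphi ?; split=> // [z|]; [exact: sqr_ge0|exact: measurable_funX]. Qed.

(** * Means and variances of square-integrable functions *)

Section square_integrable.
Variables (k : nat) (phi : k.-tuple R -> R).
Hypothesis mphi : measurable_fun setT phi.
Hypothesis phi2 : cube_nnintegrable (fun z => phi z ^+ 2).

(** Since the cube has mass 1, this makes the positive and negative parts of a square-integrable
    function integrable. *)
Let max2 (x : R) : Num.max x 0 <= x ^+ 2 + 1.
Proof.
have := sqr_ge0 x; have := sqr_ge0 (x - 1).
by rewrite ge_max => ? ?; apply/andP; split; nra.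
Qed.

Let maxBmax (x : R) : x = Num.max x 0 - Num.max (- x) 0.
Proof. by rewrite !maxEle; case: leP => ?; case: leP => ?; lra. Qed.

Let i1 : cube_nnintegrable (fun=> 1 : R) := cube_nnintegrable_cst k ler01.

Lemma cube_nnintegrable_pos : cube_nnintegrable (fun z => Num.max (phi z) 0).
Proof.
apply: cube_nnintegrable_le (cube_nnintegrableD phi2 i1).
- by move=> z; rewrite le_max lexx orbT.
- exact: measurable_maxr.
- by move=> z _; exact: max2.
Qed.

Lemma cube_nnintegrable_neg : cube_nnintegrable (fun z => Num.max (- phi z) 0).
Proof.
apply: cube_nnintegrable_le (cube_nnintegrableD phi2 i1).
- by move=> z; rewrite le_max lexx orbT.
- by apply: measurable_maxr => //; exact: measurable_funN.
- by move=> z _; rewrite -sqrrN; exact: max2.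
Qed.

Lemma cube_nnintegrable_sqr_shift a :
  cube_nnintegrable (fun z => (phi z - a) ^+ 2).
Proof.
have ia : cube_nnintegrable (fun _ : k.-tuple R => a ^+ 2).
  by apply: cube_nnintegrable_cst; exact: sqr_ge0.
apply: cube_nnintegrable_le
  (cube_nnintegrableZ (cube_nnintegrableD phi2 ia) (ler0n R 2)).
- by move=> z; exact: sqr_ge0.
- by apply: measurable_funX; exact: measurable_funB.
(* The majorant [2 * (phi z ^+ 2 + a ^+ 2)] exceeds [(phi z - a) ^+ 2] by exactly this square. *)
- by move=> z _; have := sqr_ge0 (phi z + a); nra.
Qed.

(* [cube_int] is additive on nonnegative functions only, hence the split of
   [a] and [phi] into positive and negative parts, with no subtraction. *)
Lemma sq_int_shift a :
  sq_int (fun z => phi z - a) = sq_int phi - 2 * a * cube_mean phi + a ^+ 2.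
Proof.
have ip := cube_nnintegrable_pos; have iN := cube_nnintegrable_neg.
have iS := cube_nnintegrable_sqr_shift a.
have ia : cube_nnintegrable (fun _ : k.-tuple R => a ^+ 2).
  by apply: cube_nnintegrable_cst; exact: sqr_ge0.
pose p := Num.max a 0; pose q := Num.max (- a) 0.
have p0 : 0 <= 2 * p by rewrite mulr_ge0// le_max lexx orbT.
have q0 : 0 <= 2 * q by rewrite mulr_ge0// le_max lexx orbT.
have E : (fun z => (phi z - a) ^+ 2 +
     (2 * p * Num.max (phi z) 0 + 2 * q * Num.max (- phi z) 0)) =
  (fun z => (phi z ^+ 2 + a ^+ 2) +
     (2 * q * Num.max (phi z) 0 + 2 * p * Num.max (- phi z) 0)).
  apply/funext => z; move: (maxBmax (phi z)) (maxBmax a); rewrite -/p -/q.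
  move: (Num.max (phi z) 0) (Num.max (- phi z) 0) (p) (q) => P N p' q' -> ->.
  ring.
have := congr1 (@cube_Rint k) E.
rewrite (cube_RintD iS); last by apply: cube_nnintegrableD; exact: cube_nnintegrableZ.
rewrite (cube_RintD (cube_nnintegrableD phi2 ia)); last first.
  by apply: cube_nnintegrableD; exact: cube_nnintegrableZ.
rewrite (cube_RintD phi2 ia) !(cube_RintD (cube_nnintegrableZ _ _))//;
  do ?exact: cube_nnintegrableZ.
rewrite cube_Rint_cst !cube_RintZ// => {}E.
rewrite /sq_int /cube_mean -!/(cube_Rint _).
have := maxBmax a; rewrite -/p -/q => a_pq.
move: E; rewrite {4}a_pq.
move: (cube_Rint _) (cube_Rint _) (cube_Rint _) (cube_Rint _) => A S P N.
lra.
Qed.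

End square_integrable.

Lemma cube_var_sq_int k (phi : k.-tuple R -> R) :
  measurable_fun setT phi -> cube_nnintegrable (fun z => phi z ^+ 2) ->
  cube_var phi = sq_int (fun z => phi z - cube_mean phi).
Proof. by move=> mphi phi2; rewrite sq_int_shift// /cube_var; ring. Qed.

Lemma sq_int_ge0 k (phi : k.-tuple R -> R) : 0 <= sq_int phi.
Proof. by apply: cube_Rint_ge0 => z; exact: sqr_ge0. Qed.

Lemma cube_var_ge0 k (phi : k.-tuple R -> R) :
  measurable_fun setT phi -> cube_nnintegrable (fun z => phi z ^+ 2) ->
  0 <= cube_var phi.
Proof. by move=> mphi phi2; rewrite cube_var_sq_int// sq_int_ge0. Qed.

Lemma cube_var_eq0 k (phi : k.-tuple R -> R) :
  measurable_fun setT phi -> cube_nnintegrable (fun z => phi z ^+ 2) ->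
  cube_var phi = 0 -> ae_const phi.
Proof.
move=> mphi phi2; rewrite cube_var_sq_int//; set a := cube_mean phi => var0.
exists a.
have int0 : (cube_int (fun z => ((phi z - a) ^+ 2)%:E) = 0)%E.
  rewrite cube_RintK; last exact: cube_nnintegrable_sqr_shift.
  by rewrite -[cube_Rint _]/(sq_int _) var0.
have msq : measurable_fun setT (fun z => ((phi z - a) ^+ 2)%:E).
  by apply/measurable_EFinP/measurable_funX; exact: measurable_funB.
have sq0 z : (0 <= ((phi z - a) ^+ 2)%:E)%E by rewrite lee_fin sqr_ge0.
apply/eqP; rewrite eq_le; apply/andP; split; last first.
  by apply: cube_int_ge0 => z; rewrite lee_fin.
(* Multiplied by [+oo], the squared deviation still has integral zero, and it is infinite wherever
   [phi] differs from [a], so it dominates the indicator of that set. *)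
have <- : (cube_int (fun z => +oo * ((phi z - a) ^+ 2)%:E) = 0)%E.
  by rewrite cube_intZ ?leey// int0 mule0.
apply: le_cube_int.
- by move=> z; rewrite lee_fin.
- apply/measurable_EFinP/measurable_indic.
  rewrite [X in measurable X](_ : _ = ~` (phi @^-1` [set a])).
    by apply: measurableC; rewrite -[X in measurable X]setTI; exact: mphi.
  by apply/seteqP; split=> z /= /eqP.
- exact: measurable_funeM.
- move=> z _; rewrite indicE; case: (boolP (z \in _)) => [|_]; last first.
    by rewrite mule_ge0// leey.
  rewrite inE/= => phiza; rewrite gt0_mulye ?leey// lte_fin.
  by rewrite exprn_even_gt0//= subr_eq0.
Qed.

(** The mean is the best constant approximation: the two sides differ by
    [(cube_mean phi - a) ^+ 2]. *)
Lemma cube_var_le_sq_int_shift k (phi : k.-tuple R -> R) a :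
  measurable_fun setT phi -> cube_nnintegrable (fun z => phi z ^+ 2) ->
  cube_var phi <= sq_int (fun z => phi z - a).
Proof.
move=> mphi phi2; rewrite sq_int_shift// /cube_var.
have := sqr_ge0 (cube_mean phi - a); nra.
Qed.

(** * Variance under a Lipschitz map *)

Section lipschitz.
Variables (k : nat) (phi psi : k.-tuple R -> R) (G : R -> R) (L : R).
Hypothesis lipG : forall u u0, `|G u - G u0| <= L * `|u - u0|.
Hypothesis psiE : forall z, cube z -> psi z = G (phi z).
Hypotheses (mphi : measurable_fun setT phi) (mpsi : measurable_fun setT psi).
Hypothesis phi2 : cube_nnintegrable (fun z => phi z ^+ 2).

Let sq_le a z : cube z -> (psi z - G a) ^+ 2 <= L ^+ 2 * (phi z - a) ^+ 2.
Proof.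
move=> cz; rewrite psiE// -exprMn -real_normK ?num_real//.
rewrite -[leRHS]real_normK ?num_real// lerXn2r ?nnegrE//.
(* The sign of [L] is not fixed in this section, so the comparison of absolute values passes through
   [L <= |L|]. *)
by apply: le_trans (lipG _ _) _; rewrite normrM ler_wpM2r// ler_norm.
Qed.

Lemma lipschitz_sqr_nnintegrable : cube_nnintegrable (fun z => psi z ^+ 2).
Proof.
have i0 := cube_nnintegrable_sqr_shift mphi phi2 0.
have iG : cube_nnintegrable (fun _ : k.-tuple R => G 0 ^+ 2).
  by apply: cube_nnintegrable_cst; exact: sqr_ge0.
have iL := cube_nnintegrableZ i0 (sqr_ge0 L).
apply: cube_nnintegrable_le
  (cube_nnintegrableZ (cube_nnintegrableD iL iG) (ler0n R 2)).
- by move=> z; exact: sqr_ge0.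
- exact: measurable_funX.
- move=> z cz; have := sq_le 0 cz.
  (* This square is the gap in [psi^2 <= 2 * ((psi - G 0)^2 + (G 0)^2)]. *)
  have := sqr_ge0 (psi z - 2 * G 0); nra.
Qed.

(** Centring [psi] at [G (cube_mean phi)] instead of at its own mean can only increase the squared
    deviation, and there the Lipschitz bound applies pointwise. *)
Lemma cube_var_lipschitz : cube_var psi <= L ^+ 2 * cube_var phi.
Proof.
have psi2 := lipschitz_sqr_nnintegrable.
apply: le_trans (cube_var_le_sq_int_shift (G (cube_mean phi)) mpsi psi2) _.
have iphi := cube_nnintegrable_sqr_shift mphi phi2 (cube_mean phi).
rewrite [cube_var phi]cube_var_sq_int// -cube_RintZ ?sqr_ge0//.
apply: le_cube_Rint.
- exact: cube_nnintegrable_sqr_shift.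
- by apply: cube_nnintegrableZ => //; exact: sqr_ge0.
- by move=> z cz; exact: sq_le.
Qed.

End lipschitz.

(** * Sections along one coordinate and partial integrals *)

Section partial.
Variables (k : nat) (j : 'I_k) (phi : k.-tuple R -> R).
Hypothesis mphi : measurable_fun setT phi.

(* A [1.-tuple] argument, so that the results on [cube_int] apply to sections. *)
Definition slice (w : k.-1.-tuple R) (u : 1.-tuple R) : R :=
  phi (tins j (thead u) w).

(** Extended-real valued, because individual sections of a square-integrable function may fail to be
    square integrable. *)
Definition partial_sq (w : k.-1.-tuple R) : \bar R :=
  (\int[mu]_(t in `]0%R, 1%R[) (phi (tins j t w) ^+ 2)%:E)%E.

Lemma cube_int_slice w (F : R -> \bar R) :
  cube_int (fun u => F (slice w u)) =
  (\int[mu]_(t in `]0%R, 1%R[) F (phi (tins j t w)))%E.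
Proof. by []. Qed.

Lemma measurable_slice w : measurable_fun setT (slice w).
Proof.
have mw : measurable_fun setT (fun u : 1.-tuple R => (w, thead u)).
  by apply: measurable_fun_pair => //; exact: measurable_tnth.
exact: measurableT_comp mphi (measurableT_comp (measurable_tins j) mw).
Qed.

Lemma sqr_slice_nnintegrable w : (partial_sq w < +oo)%E ->
  cube_nnintegrable (fun u => slice w u ^+ 2).
Proof. by move=> woo; apply: cube_nnintegrable_sqr => //; exact: measurable_slice. Qed.

(** Valid for every [w], integrable section or not; measurability of [partial_int] is read off from
    this form. *)
Lemma partial_intE w : partial_int j phi w =
  fine (\int[mu]_(t in `]0%R, 1%R[) (Num.max (phi (tins j t w)) 0)%:E
       - \int[mu]_(t in `]0%R, 1%R[) (Num.max (- phi (tins j t w)) 0)%:E)%E.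
Proof.
rewrite /partial_int integralE; congr (fine (_ - _)%E).
  by apply: eq_integral => t _; rewrite funeposE EFin_max.
by apply: eq_integral => t _; rewrite funenegE -EFinN EFin_max.
Qed.

(** [partial_int] applies [fine] after subtracting the two parts, [cube_mean] before; the results
    agree once both parts are finite. *)
Lemma partial_int_cube_mean w : (partial_sq w < +oo)%E ->
  partial_int j phi w = cube_mean (slice w).
Proof.
move=> /sqr_slice_nnintegrable sw; have ms := measurable_slice w.
rewrite partial_intE fineB//.
- have ip := cube_nnintegrable_pos ms sw.
  by rewrite -(cube_int_slice w (fun x => (Num.max x 0)%:E)) (cube_RintK ip).
- have ip := cube_nnintegrable_neg ms sw.
  by rewrite -(cube_int_slice w (fun x => (Num.max (- x) 0)%:E)) (cube_RintK ip).
Qed.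

(** Jensen's inequality, obtained from the nonnegative variance of the section; a section with
    infinite square integral is trivial. *)
Lemma sqr_partial_int_le w : ((partial_int j phi w ^+ 2)%:E <= partial_sq w)%E.
Proof.
have [woo|] := ltP (partial_sq w) +oo%E; last first.
  by rewrite leye_eq => /eqP ->; rewrite leey.
have sw := sqr_slice_nnintegrable woo.
rewrite partial_int_cube_mean//.
rewrite -[partial_sq w]/(cube_int (fun u => (slice w u ^+ 2)%:E)).
rewrite cube_RintK// lee_fin -subr_ge0.
by apply: cube_var_ge0 => //; exact: measurable_slice.
Qed.

Let measurable_phi_tins :
  measurable_fun setT (fun p : k.-1.-tuple R * R => phi (tins j p.2 p.1)).
Proof. exact: measurableT_comp mphi (measurable_tins j). Qed.

Lemma partial_sq_ge0 w : (0 <= partial_sq w)%E.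
Proof. by apply: integral_ge0 => t _; rewrite lee_fin sqr_ge0. Qed.

Lemma measurable_partial_sq : measurable_fun setT partial_sq.
Proof.
apply: (measurable_int01 (F := fun p => (phi (tins j p.2 p.1) ^+ 2)%:E)).
  by move=> p; rewrite lee_fin sqr_ge0.
exact/measurable_EFinP/measurable_funX.
Qed.

Lemma measurable_partial_int : measurable_fun setT (partial_int j phi).
Proof.
rewrite (funext partial_intE).
apply: measurableT_comp => //=.
apply: emeasurable_funB.
- apply: (measurable_int01 (F := fun p => (Num.max (phi (tins j p.2 p.1)) 0)%:E)).
    by move=> p; rewrite lee_fin le_max lexx orbT.
  exact/measurable_EFinP/measurable_maxr.
- apply: (measurable_int01 (F := fun p => (Num.max (- phi (tins j p.2 p.1)) 0)%:E)).
    by move=> p; rewrite lee_fin le_max lexx orbT.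
  by apply/measurable_EFinP/measurable_maxr => //; exact: measurable_funN.
Qed.

Lemma cube_int_partial_sq :
  cube_int (fun z => (phi z ^+ 2)%:E) = cube_int partial_sq.
Proof.
apply: cube_int_tins.
- by move=> z; rewrite lee_fin sqr_ge0.
- exact/measurable_EFinP/measurable_funX.
Qed.

Lemma sqr_partial_int_nnintegrable :
  (cube_int (fun z => (phi z ^+ 2)%:E) < +oo)%E ->
  cube_nnintegrable (fun w => partial_int j phi w ^+ 2).
Proof.
move=> phioo; apply: cube_nnintegrable_sqr; first exact: measurable_partial_int.
apply: le_lt_trans phioo; rewrite cube_int_partial_sq; apply: le_cube_int.
- by move=> z; rewrite lee_fin sqr_ge0.
- by apply/measurable_EFinP/measurable_funX; exact: measurable_partial_int.
- exact: measurable_partial_sq.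
- by move=> w _; exact: sqr_partial_int_le.
Qed.

(** This makes the numerator of a total Sobol index nonnegative. *)
Lemma sq_int_partial_int_le :
  (cube_int (fun z => (phi z ^+ 2)%:E) < +oo)%E ->
  sq_int (partial_int j phi) <= sq_int phi.
Proof.
move=> phioo; rewrite -lee_fin -(cube_RintK (sqr_partial_int_nnintegrable phioo)).
rewrite -(cube_RintK (cube_nnintegrable_sqr mphi phioo)) cube_int_partial_sq.
apply: le_cube_int.
- by move=> z; rewrite lee_fin sqr_ge0.
- by apply/measurable_EFinP/measurable_funX; exact: measurable_partial_int.
- exact: measurable_partial_sq.
- by move=> w _; exact: sqr_partial_int_le.
Qed.

End partial.

(** * Independence of values outside the cube *)

Section congruence.
Variables (k : nat) (phi psi : k.-tuple R -> R).
Hypothesis eq_phi : forall z, cube z -> phi z = psi z.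

Lemma eq_sq_int : sq_int phi = sq_int psi.
Proof. by congr fine; apply: eq_cube_int => z cz; rewrite eq_phi. Qed.

Lemma eq_cube_mean : cube_mean phi = cube_mean psi.
Proof.
by congr (fine _ - fine _); apply: eq_cube_int => z cz; rewrite eq_phi.
Qed.

Lemma eq_cube_var : cube_var phi = cube_var psi.
Proof. by rewrite /cube_var eq_sq_int eq_cube_mean. Qed.

Lemma eq_ae_const : ae_const phi -> ae_const psi.
Proof.
move=> [a phia]; exists a; rewrite -phia; apply: eq_cube_int => z cz.
rewrite !indicE; congr (nat_of_bool _)%:R%:E.
by apply/idP/idP; rewrite !inE/= eq_phi.
Qed.

End congruence.

Lemma eq_total_sobol k (phi psi : k.-tuple R -> R) (j : 'I_k) :
  (forall z, cube z -> phi z = psi z) -> total_sobol phi j = total_sobol psi j.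
Proof.
move=> eq_phi; rewrite /total_sobol (eq_sq_int eq_phi) (eq_cube_var eq_phi).
congr ((_ - _) / _); apply: eq_sq_int => w cw; congr fine.
apply: eq_integral => t; rewrite inE/= in_itv/= => t01.
by rewrite eq_phi//; exact: cube_tins.
Qed.

(** Extension by zero supplies the global measurability assumed above, and by the congruence lemmas
    it changes neither means, variances nor indices. *)
Lemma L2cube_restrict k (phi : k.-tuple R -> R) : L2cube phi ->
  measurable_fun setT (phi \_ (@cube R k)) /\
  (cube_int (fun z => ((phi \_ (@cube R k)) z ^+ 2)%:E) < +oo)%E.
Proof.
move=> [mphi phioo]; split.
  by apply/(measurable_restrictT _ (measurable_cube (k := k))).
rewrite (eq_cube_int (psi := fun z => (phi z ^+ 2)%:E))// => z cz.
by rewrite patchE mem_set.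
Qed.

(** With [n.+1] inputs, [(n.+1 + m).-1] converts to [n + m], so [w] lists the [n] entries of
    [x_{~i}] and then [xi]. *)
Lemma xpart_tins n m (i : 'I_n.+1) (t : R) (w : (n + m).-tuple R) :
  xpart (tins (lshift m i : 'I_(n.+1 + m)) t w) = tins i t (xpart w).
Proof.
apply: eq_tins => [|l]; first by rewrite tnth_mktuple tnth_tins_id.
rewrite !tnth_mktuple.
have -> : lshift m (lift i l) = lift (lshift m i : 'I_(n.+1 + m)) (lshift m l).
  exact: val_inj.
by rewrite liftK.
Qed.

(** * Numerator and second-moment bounds for [g] *)

Section sobol_bounds.
Variables (G : R -> R -> R) (L c : R).
Hypotheses (hc : 0 < c) (hLc : c <= L).
Hypothesis hLip : forall u u0 v, `|G u v - G u0 v| <= L * `|u - u0|.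
Hypothesis hlow : forall u v, c * Num.sqrt (u ^+ 2 + v ^+ 2) <= `|G u v|.
Variables (n m : nat) (i : 'I_n.+1).
Variables (f : n.+1.-tuple R -> R) (h : (n + m).-tuple R -> R)
  (g : (n.+1 + m).-tuple R -> R).
Hypotheses (mf : measurable_fun setT f) (mh : measurable_fun setT h)
  (mg : measurable_fun setT g).
Hypothesis foo : (cube_int (fun z => (f z ^+ 2)%:E) < +oo)%E.
Hypothesis hoo : (cube_int (fun z => (h z ^+ 2)%:E) < +oo)%E.
Hypothesis goo : (cube_int (fun z => (g z ^+ 2)%:E) < +oo)%E.
Let j : 'I_(n.+1 + m) := lshift m i.
Hypothesis gE : forall z, cube z -> g z = G (f (xpart z)) (h (drop_coord j z)).

(** The variance inequality between the sections of [g] and [f], rearranged without subtraction so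
    that it makes sense for infinite values. *)
Let slice_var_le (w : (n + m).-tuple R) : cube w ->
  (partial_sq j g w + (L ^+ 2 * partial_int i f (xpart w) ^+ 2)%:E <=
   (L ^+ 2)%:E * partial_sq i f (xpart w) + (partial_int j g w ^+ 2)%:E)%E.
Proof.
(* Strict positivity makes the right side [+oo] when the section of [f] is not square integrable. *)
move=> cw; have L20 : 0 < L ^+ 2 by rewrite exprn_gt0// (lt_le_trans hc).
have [foo'|] := ltP (partial_sq i f (xpart w)) +oo%E; last first.
  by rewrite leye_eq => /eqP ->; rewrite gt0_muley ?lte_fin// addye ?leey.
have fw := sqr_slice_nnintegrable mf foo'.
have mfw := measurable_slice i mf (xpart w).
have mgw := measurable_slice j mg w.
have lip u u0 := hLip u u0 (h w).
have gw u : cube u -> slice j g w u = G (slice i f (xpart w) u) (h w).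
  move=> cu; rewrite /slice gE; last by apply: cube_tins => //; exact: cu.
  by rewrite drop_coord_tins xpart_tins.
have gw2 := lipschitz_sqr_nnintegrable lip gw mfw mgw fw.
(* The section of [g] inherits square integrability from that of [f], so both partial integrals are
   section means. *)
have goo' : (partial_sq j g w < +oo)%E by case: gw2.
have := cube_var_lipschitz lip gw mfw mgw fw.
rewrite -[partial_sq j g w]/(cube_int (fun u => (slice j g w u ^+ 2)%:E)).
rewrite -[partial_sq i f _]/(cube_int (fun u => (slice i f (xpart w) u ^+ 2)%:E)).
rewrite !cube_RintK// !partial_int_cube_mean// -EFinM -!EFinD lee_fin.
by rewrite /cube_var -![sq_int _]/(cube_Rint _); lra.
Qed.

(** Integrating [slice_var_le] over [w], the terms in [f] lose their dependence on [xi] by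
    [cube_int_xpart], and Tonelli recombines the sections. All four integrals are finite, so the
    subtractions can be restored. *)
Lemma sobol_numerator_le :
  sq_int g - sq_int (partial_int j g) <=
  L ^+ 2 * (sq_int f - sq_int (partial_int i f)).
Proof.
have L20 := sqr_ge0 L.
have if2 := cube_nnintegrable_sqr mf foo.
have ig2 := cube_nnintegrable_sqr mg goo.
have ipf := sqr_partial_int_nnintegrable i mf foo.
have ipg := sqr_partial_int_nnintegrable j mg goo.
have mpf := measurable_partial_int i mf.
have mpg := measurable_partial_int j mg.
have mxp : measurable_fun setT (fun w : (n + m).-tuple R => xpart w : n.-tuple R).
  exact: measurable_xpart.
have mpfx : measurable_fun setT
    (fun w : (n + m).-tuple R => (L ^+ 2 * partial_int i f (xpart w) ^+ 2)%:E).
  apply/measurable_EFinP/measurable_funM => //; apply: measurable_funX.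
  exact: measurableT_comp mpf mxp.
have msg : measurable_fun setT (fun w : (n + m).-tuple R => partial_sq j g w).
  exact: (measurable_partial_sq j mg).
have msf : measurable_fun setT
    (fun w : (n + m).-tuple R => partial_sq i f (xpart w)).
  exact: measurableT_comp (measurable_partial_sq i mf) mxp.
have msgp : measurable_fun setT
    (fun w : (n + m).-tuple R => (partial_int j g w ^+ 2)%:E).
  exact/measurable_EFinP/measurable_funX.
have sg0 (w : (n + m).-tuple R) : (0 <= partial_sq j g w)%E.
  exact: partial_sq_ge0.
have sf0 (w : (n + m).-tuple R) : (0 <= partial_sq i f (xpart w))%E.
  exact: partial_sq_ge0.
have pf0 (w : (n + m).-tuple R) :
    (0 <= (L ^+ 2 * partial_int i f (xpart w) ^+ 2)%:E)%E.
  by rewrite lee_fin mulr_ge0// sqr_ge0.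
have pg0 (w : (n + m).-tuple R) : (0 <= (partial_int j g w ^+ 2)%:E)%E.
  by rewrite lee_fin sqr_ge0.
have Lsf0 (w : (n + m).-tuple R) :
    (0 <= (L ^+ 2)%:E * partial_sq i f (xpart w))%E.
  by rewrite mule_ge0.
have mLsf := measurable_funeM (L ^+ 2)%:E msf.
have := le_cube_int (fun w => adde_ge0 (sg0 w) (pf0 w))
  (emeasurable_funD msg mpfx) (emeasurable_funD mLsf msgp) slice_var_le.
rewrite (cube_intD sg0 msg pf0 mpfx) (cube_intD Lsf0 mLsf pg0 msgp).
rewrite (cube_intZ sf0 msf)//.
rewrite (cube_int_xpart m (partial_sq i f)).
rewrite (cube_int_xpart m (fun w => (L ^+ 2 * partial_int i f w ^+ 2)%:E)).
rewrite (cube_int_EFinZ ipf L20) (cube_RintK ipg).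
rewrite -(cube_int_partial_sq i mf) (cube_RintK if2).
rewrite -(cube_int_partial_sq j mg) (cube_RintK ig2).
rewrite -EFinM -!EFinD lee_fin.
by rewrite /sq_int -!/(cube_Rint _); lra.
Qed.

Lemma sq_int_lower : c ^+ 2 * (sq_int f + sq_int h) <= sq_int g.
Proof.
have c20 := sqr_ge0 c.
have ig2 := cube_nnintegrable_sqr mg goo.
have mxp : measurable_fun setT (fun z : (n.+1 + m).-tuple R => f (xpart z)).
  exact: (measurableT_comp mf (@measurable_xpart n.+1 m)).
have mdc : measurable_fun setT
    (fun z : (n.+1 + m).-tuple R => h (drop_coord j z)).
  exact: (measurableT_comp mh (measurable_drop_coord j)).
have fE := cube_int_xpart m (fun z => (f z ^+ 2)%:E).
(* With coordinate [j] innermost, the integrand is constant in it and the integral over the unit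
   interval disappears. *)
have hE : cube_int (fun z => (h (drop_coord j z) ^+ 2)%:E) =
          cube_int (fun z => (h z ^+ 2)%:E).
  rewrite (cube_int_tins j).
  - congr cube_int; apply/funext => w.
    rewrite -[RHS]int01_cst; apply: eq_integral => t _.
    by rewrite drop_coord_tins.
  - by move=> z; rewrite lee_fin sqr_ge0.
  - exact/measurable_EFinP/measurable_funX.
have ifx : cube_nnintegrable (fun z : (n.+1 + m).-tuple R => f (xpart z) ^+ 2).
  by apply: cube_nnintegrable_sqr => //; rewrite fE.
have ihd : cube_nnintegrable
    (fun z : (n.+1 + m).-tuple R => h (drop_coord j z) ^+ 2).
  by apply: cube_nnintegrable_sqr => //; rewrite hE.
have -> : sq_int f = cube_Rint (fun z : (n.+1 + m).-tuple R => f (xpart z) ^+ 2).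
  by rewrite /sq_int -fE.
have -> : sq_int h =
    cube_Rint (fun z : (n.+1 + m).-tuple R => h (drop_coord j z) ^+ 2).
  by rewrite /sq_int -hE.
rewrite -cube_RintD// -cube_RintZ//; last exact: cube_nnintegrableD.
apply: le_cube_Rint => //.
  by apply: cube_nnintegrableZ => //; exact: cube_nnintegrableD.
move=> z cz; rewrite gE//.
set u := f _; set v := h _.
have uv0 : 0 <= u ^+ 2 + v ^+ 2 by rewrite addr_ge0// sqr_ge0.
rewrite -[leRHS]real_normK ?num_real// -(sqr_sqrtr uv0) -exprMn.
by rewrite lerXn2r ?nnegrE// mulr_ge0// ?sqrtr_ge0// ltW.
Qed.

End sobol_bounds.

End cube_integral.

(** * Comparison of the two indices *)

Theorem theoremD4 (R : realType) (G : R -> R -> R) (L c : R)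
  (hc : 0 < c) (hLc : c <= L)
  (hLip : forall u u0 v : R, `|G u v - G u0 v| <= L * `|u - u0|)
  (hlow : forall u v : R, c * Num.sqrt (u ^+ 2 + v ^+ 2) <= `|G u v|)
  (n m : nat) (hn : (1 <= n)%N) (hm : (1 <= m)%N) (i : 'I_n)
  (f : n.-tuple R -> R) (h : (n + m).-1.-tuple R -> R)
  (g : (n + m).-tuple R -> R)
  (hf : L2cube f) (hfnc : ~ ae_const f) (hh : L2cube h) (hg : L2cube g)
  (hgdef : forall z, cube z ->
     g z = G (f (xpart z)) (h (drop_coord (lshift m i) z)))
  (hg0 : cube_mean g = 0) :
  total_sobol g (lshift m i) <=
    2 * (L ^+ 2 / c ^+ 2) * (cube_var f / (cube_var f + cube_var h))
      * total_sobol f i.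
Proof.
case: n hn i f h g hf hfnc hh hg hgdef hg0 => // n _ i f h g.
(* From here [f], [h] and [g] are traded for their extensions by zero. The relation defining [g]
   survives because [xpart] and [drop_coord] map the cube into a cube. *)
move=> hf hfnc hh hg hgdef hg0.
have rE k (phi : k.-tuple R -> R) z : cube z -> phi z = (phi \_ (@cube R k)) z.
  by move=> cz; rewrite patchE mem_set.
have {hgdef} : forall z, cube z -> (g \_ (@cube R _)) z =
    G ((f \_ (@cube R _)) (xpart z))
      ((h \_ (@cube R _)) (drop_coord (lshift m i) z)).
  move=> z cz; rewrite -!rE//; first exact: hgdef.
  - exact: cube_drop_coord.
  - exact: cube_xpart.
rewrite (eq_total_sobol _ (@rE _ g)) (eq_total_sobol _ (@rE _ f)).
rewrite (eq_cube_var (@rE _ f)) (eq_cube_var (@rE _ h)).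
move: hg0; rewrite (eq_cube_mean (@rE _ g)).
have {}hfnc : ~ ae_const (f \_ (@cube R _)).
  by move=> /(eq_ae_const (fun z cz => esym (rE _ _ z cz))).
move: hfnc (L2cube_restrict hf) (L2cube_restrict hh) (L2cube_restrict hg).
move: (f \_ _) (h \_ _) (g \_ _) => {hf hh hg}{}f {}h {}g.
move=> fnc [mf foo] [mh hoo] [mg goo] g0 gE.
have f2 := cube_nnintegrable_sqr mf foo.
have h2 := cube_nnintegrable_sqr mh hoo.
have num_le := sobol_numerator_le hc hLc hLip mf mg foo goo gE.
have g_ge := sq_int_lower hc hlow mf mh mg foo hoo goo gE.
(* Strictness comes from [f] not being a.e. constant; it allows [cube_var f] to be cancelled and
   makes the final denominator positive. *)
have Vf0 : 0 < cube_var f.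
  rewrite lt_neqAle cube_var_ge0// andbT eq_sym.
  by apply/eqP => /(cube_var_eq0 mf f2).
have Vh0 := cube_var_ge0 mh h2.
have Vg : cube_var g = sq_int g by rewrite /cube_var g0 expr0n subr0.
have Nf0 : 0 <= sq_int f - sq_int (partial_int i f).
  by rewrite subr_ge0; exact: sq_int_partial_int_le.
rewrite /total_sobol Vg.
move: num_le Nf0; set Ng := sq_int g - _; set Nf := sq_int f - _ => num_le Nf0.
have c20 : 0 < c ^+ 2 by rewrite exprn_gt0.
have V0 : 0 < c ^+ 2 * (cube_var f + cube_var h).
  by rewrite mulr_gt0// ltr_wpDr.
have g_geV : c ^+ 2 * (cube_var f + cube_var h) <= sq_int g.
  apply: le_trans g_ge; rewrite ler_pM2l// /cube_var.
  by rewrite lerD// gerBl sqr_ge0.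
(* The factor [cube_var f] cancels against the denominator of the index of [f]. *)
have -> : 2 * (L ^+ 2 / c ^+ 2) * (cube_var f / (cube_var f + cube_var h)) *
    (Nf / cube_var f) = 2 * (L ^+ 2 * Nf) / (c ^+ 2 * (cube_var f + cube_var h)).
  by field; rewrite !gt_eqF// ltr_wpDr.
have LN0 : 0 <= L ^+ 2 * Nf by rewrite mulr_ge0// sqr_ge0.
(* The numerator bound is used first; then [sq_int g] is replaced by its lower bound, and the factor
   2 is given away since [L ^+ 2 * Nf] is nonnegative. *)
apply: le_trans (_ : L ^+ 2 * Nf / sq_int g <= _).
  by rewrite ler_pM2r// invr_gt0 (lt_le_trans V0).
apply: ler_pM => //; first by rewrite invr_ge0 (le_trans (ltW V0)).
- by lra.
- by rewrite lef_pV2// posrE (lt_le_trans V0).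
Qed.
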